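(* Suppose the disutilities of drivers follow the additive random utility assumption given in the context. Then the master problem $$\max_{\mathbf{f}}\ \sum_{od\in\mathcal{W}}z^\star_{od}(\mathbf{f})\quad\text{s.t.}\quad \sum_{rs\in\mathcal{T}}f^{rs}_{od}=q_{od}\ \ \forall od\in\mathcal{W},\qquad \sum_{od\in\mathcal{W}}f^{rs}_{od}\le n_{rs}\ \ \forall rs\in\mathcal{T},\qquad f^{rs}_{od}\in\mathbb{Z}_{\geq 0},$$ has as its fluid approximation the problem $$\max_{\mathbf{f}\ge\mathbf{0}}\ \sum_{od\in\mathcal{W}}\sum_{rs\in\mathcal{T}}f^{rs}_{od}(\overline{c}_{rs}-C^{rs}_{od})-\sum_{od\in\mathcal{W}}\hat{H}_{od}(\mathbf{f})\quad\text{s.t.}\quad \sum_{rs\in\mathcal{T}}f^{rs}_{od}=q_{od}\ \ \forall od\in\mathcal{W},\qquad \sum_{od\in\mathcal{W}}f^{rs}_{od}\le n_{rs}\ \ \forall rs\in\mathcal{T},$$ where $$\hat{H}_{od}(\mathbf{f})=\max_{\mathbf{v}_{od}\in\mathbb{R}^{\mathcal{T}}}\Big\{\sum_{rs\in\mathcal{T}}f^{rs}_{od}v^{rs}_{od}-q_{od}\,S_{od}(\mathbf{v}_{od})\Big\}.$$ That is, replacing in the master problem each $z^\star_{od}$ by its fluid approximation $\tilde z_{od}$ (defined in the context) and the integrality constraints by $\mathbf{f}\ge\mathbf{0}$ yields exactly the latter problem (same feasible set and same objective function).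
   Context: $\mathcal{W}$ (origin-destination pairs of drivers) and $\mathcal{T}$ (pickup-delivery pairs) are finite nonempty sets. For $od\in\mathcal{W}$, $\mathcal{A}_{od}$ is the finite nonempty set of drivers with OD pair $od$ and $q_{od}=|\mathcal{A}_{od}|$. For $rs\in\mathcal{T}$, $n_{rs}$ is the number of tasks and $\overline{c}_{rs}\in\mathbb{R}$ the dedicated-vehicle cost. $c^{rs}_a$ is the disutility of driver $a$ for a task for $rs$; $f^{rs}_{od}$ is the number of tasks for $rs$ allocated to $\mathcal{A}_{od}$. For given $\mathbf{f}$, $z^\star_{od}(\mathbf{f})$ is the optimal value of the sub-problem of maximizing $\sum_{a\in\mathcal{A}_{od}}\sum_{rs\in\mathcal{T}}(\overline{c}_{rs}-c^{rs}_a)y^{rs}_a$ subject to $\sum_{rs}y^{rs}_a=1$ for all $a\in\mathcal{A}_{od}$, $\sum_{a\in\mathcal{A}_{od}}y^{rs}_a=f^{rs}_{od}$ for all $rs\in\mathcal{T}$, $y^{rs}_a\in\{0,1\}$. By Lagrangian duality, $z^\star_{od}(\mathbf{f})=\min_{\boldsymbol{\sigma}}\big\{\sum_{a\in\mathcal{A}_{od}}\max_{rs\in\mathcal{T}}\{\overline{c}_{rs}-c^{rs}_a-\sigma^{rs}_{od}\}+\sum_{rs}f^{rs}_{od}\sigma^{rs}_{od}\big\}$ over $\boldsymbol{\sigma}\in\mathbb{R}^{\mathcal{T}}$. Additive random utility assumption: there is a sufficiently large number of drivers for each OD pair, and the disutility is approximated by $c^{rs}_a\approx C^{rs}_{od}-\epsilon^{rs}_a$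 for $a\in\mathcal{A}_{od}$, where $C^{rs}_{od}\in\mathbb{R}$ is deterministic and the random vector $(\epsilon^{rs}_a)_{rs\in\mathcal{T}}$ follows a continuous joint distribution with finite means, independent of $C^{rs}_{od}$ (the same distribution for all drivers in $\mathcal{A}_{od}$). The expected maximum utility is $S_{od}(\mathbf{v}_{od})=\mathbb{E}\big[\max_{rs\in\mathcal{T}}\{v^{rs}_{od}+\epsilon^{rs}_a\}\big]$, $\mathbf{v}_{od}\in\mathbb{R}^{\mathcal{T}}$. Fluid approximation: under this assumption, the sum $\sum_{a\in\mathcal{A}_{od}}\max_{rs}\{\overline{c}_{rs}-c^{rs}_a-\sigma^{rs}_{od}\}$ in the dual is replaced by $q_{od}S_{od}(\mathbf{v}_{od})$ with $v^{rs}_{od}=\overline{c}_{rs}-\sigma^{rs}_{od}-C^{rs}_{od}$, giving $$\tilde z_{od}(\mathbf{f})=\min_{\boldsymbol{\sigma}\in\mathbb{R}^{\mathcal{T}}}\Big\{q_{od}\,S_{od}\big((\overline{c}_{rs}-\sigma^{rs}_{od}-C^{rs}_{od})_{rs\in\mathcal{T}}\big)+\sum_{rs\in\mathcal{T}}f^{rs}_{od}\sigma^{rs}_{od}\Big\},$$ and the integrality of $\mathbf{f}$ is relaxed to nonnegativity. Here min and max over $\boldsymbol{\sigma}$ and $\mathbf{v}_{od}$ are understood as infimum and supremum when not attained. *)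

(* Defs.v *)
From HB Require Import structures.
From mathcomp Require Import all_boot all_order all_algebra.
From mathcomp Require Import all_classical all_reals all_analysis.
Set Implicit Arguments.
Unset Strict Implicit.
Unset Printing Implicit Defensive.
Import Order.TTheory GRing.Theory Num.Theory.
Import numFieldNormedType.Exports.
Local Open Scope classical_set_scope.
Local Open Scope ring_scope.

(* Conventions:
   W : origin-destination pairs of drivers;  T : pickup-delivery pairs of tasks;
   A od : the drivers with OD pair od;  #|A od| is the number q_od of the text. *)

(* Random vectors indexed by a finite type T: the product sigma-algebra. *)

Definition cylinder (R : realType) (T : finType) : set_system (T -> R) :=
  [set X | exists rs : T, exists2 B : set R,
     measurable B & X = (fun x => x rs) @^-1` B].

Notation random_vector_space R T := (g_sigma_algebraType (@cylinder R T)).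

(* Null sets of the Lebesgue measure on R^T: coverable by countably many
   boxes of arbitrarily small total volume. *)
Definition lebesgue_null (R : realType) (T : finType) (N : set (T -> R)) :=
  forall e : R, 0 < e -> exists a b : nat -> T -> R,
    [/\ forall k rs, a k rs <= b k rs,
        N `<=` \bigcup_k [set x | forall rs, a k rs < x rs < b k rs] &
        (\sum_(0 <= k <oo) (\prod_rs (b k rs - a k rs))%:E <= e%:E)%E].

(* By Radon-Nikodym, this says that mu has a joint density. *)
Definition continuous_law (R : realType) (T : finType)
    (mu : probability (random_vector_space R T) R) : Prop :=
  forall N : set (random_vector_space R T),
    measurable N -> lebesgue_null N -> mu N = 0%E.

Definition finite_means (R : realType) (T : finType)
    (mu : probability (random_vector_space R T) R) : Prop :=
  forall rs : T, mu.-integrable setT (fun x => (x rs)%:E).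

(* The sup is a maximum since T is finite and (in all uses) nonempty. *)
Definition vmax (R : realType) (T : finType) (u : T -> R) : R := sup (range u).

(* S_od(v), where mu is the common law of the vectors eps_a, a in A_od. *)
Definition expected_max_utility (R : realType) (T : finType)
    (mu : probability (random_vector_space R T) R) (v : T -> R) : \bar R :=
  'E_mu[fun x : random_vector_space R T => vmax (fun rs => v rs + x rs)].

(* eps od a is the random vector (eps_a^rs)_rs. Its law mu od is the same for
   all a in A_od, and C is deterministic. The sign "is approximated by" is
   rendered by an error bound delta, on which nothing is assumed; delta = 0 is
   the exact additive model. *)
Record additive_random_utility (R : realType) (W T : finType)
    (A : W -> finType) (d : measure_display) (Omega : measurableType d)
    (P : probability Omega R)
    (mu : W -> probability (random_vector_space R T) R)
    (C : W -> T -> R)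
    (eps : forall od, A od -> Omega -> random_vector_space R T)
    (delta : R) (c : Omega -> forall od, A od -> T -> R) : Prop := {
  aru_measurable : forall od (a : A od), measurable_fun setT (eps od a) ;
  aru_law : forall od (a : A od) (B : set (random_vector_space R T)),
    measurable B -> P (eps od a @^-1` B) = mu od B ;
  aru_continuous : forall od, continuous_law (mu od) ;
  aru_finite_means : forall od, finite_means (mu od) ;
  aru_approx : forall w od (a : A od) rs,
    `|c w od a rs - (C od rs - eps od a w rs)| <= delta
}.

(* The problem of maximizing objective over feasible. *)
Record max_problem (X : Type) (R : realType) := MaxProblem {
  feasible : set X ;
  objective : X -> \bar R
}.

(* z*_od(f). The supremum is over a finite set, and is -oo if no assignment y
   is feasible. *)
Definition zstar (R : realType) (W T : finType) (A : W -> finType)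
    (cbar : T -> R) (c : forall od, A od -> T -> R) (od : W) (f : T -> R) :
    \bar R :=
  ereal_sup [set (\sum_(a : A od) \sum_rs
                    (cbar rs - c od a rs) * (y a rs : nat)%:R)%:E
            | y in [set y : A od -> T -> bool |
                     (forall a, \sum_rs (y a rs : nat) = 1)%N /\
                     (forall rs, (\sum_a (y a rs : nat))%N%:R = f rs)]].

(* The dual of the sub-problem, with the sum over the drivers of
   max_rs {cbar_rs - c_a^rs - sigma^rs} replaced by q_od * S_od(v). *)
Definition ztilde (R : realType) (W T : finType) (A : W -> finType)
    (cbar : T -> R) (C : W -> T -> R)
    (mu : W -> probability (random_vector_space R T) R)
    (od : W) (f : T -> R) : \bar R :=
  ereal_inf (range (fun sigma : T -> R =>
    (#|A od|%:R%:E *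
       expected_max_utility (mu od) (fun rs => cbar rs - sigma rs - C od rs)%R
     + (\sum_rs f rs * sigma rs)%R%:E)%E)).

Definition Hhat (R : realType) (W T : finType) (A : W -> finType)
    (mu : W -> probability (random_vector_space R T) R)
    (od : W) (f : T -> R) : \bar R :=
  ereal_sup (range (fun v : T -> R =>
    ((\sum_rs f rs * v rs)%R%:E
     - #|A od|%:R%:E * expected_max_utility (mu od) v)%E)).

Definition flow_constraints (R : realType) (W T : finType) (A : W -> finType)
    (n : T -> nat) (f : W -> T -> R) : Prop :=
  (forall od, \sum_rs f od rs = #|A od|%:R) /\
  (forall rs, \sum_od f od rs <= (n rs)%:R).

(* The common shape of a master problem and its fluid approximation: D is the
   domain of the variables f_od^rs, z gives the values of the sub-problems. *)
Definition allocation_problem (R : realType) (W T : finType)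
    (A : W -> finType) (n : T -> nat) (D : set R)
    (z : W -> (T -> R) -> \bar R) : max_problem (W -> T -> R) R :=
  MaxProblem
    [set f | flow_constraints A n f /\ forall od rs, D (f od rs)]
    (fun f => \sum_(od : W) z od (f od))%E.

Definition master_problem (R : realType) (W T : finType) (A : W -> finType)
    (n : T -> nat) (cbar : T -> R) (c : forall od, A od -> T -> R) :
    max_problem (W -> T -> R) R :=
  MaxProblem
    [set f | flow_constraints A n f /\
             forall od rs, exists k : nat, f od rs = k%:R]
    (fun f => \sum_(od : W) zstar cbar c od (f od))%E.

Definition perturbed_problem (R : realType) (W T : finType)
    (A : W -> finType) (n : T -> nat) (cbar : T -> R) (C : W -> T -> R)
    (mu : W -> probability (random_vector_space R T) R) :
    max_problem (W -> T -> R) R :=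
  MaxProblem
    [set f | flow_constraints A n f /\ forall od rs, 0 <= f od rs]
    (fun f => (\sum_od \sum_rs f od rs * (cbar rs - C od rs))%R%:E
              - \sum_(od : W) Hhat A mu od (f od))%E.

(* Q is obtained from P, the allocation problem with integral variables and
   values z*_od, by replacing each z*_od with ztilde_od and integrality with
   nonnegativity. Equality of problems is equality of both the feasible sets
   and the objective functions. *)
Definition is_fluid_approximation (R : realType) (W T : finType)
    (A : W -> finType) (n : T -> nat) (cbar : T -> R)
    (c : forall od, A od -> T -> R) (C : W -> T -> R)
    (mu : W -> probability (random_vector_space R T) R)
    (P Q : max_problem (W -> T -> R) R) : Prop :=
  P = allocation_problem A n [set x | exists k : nat, x = k%:R]
        (zstar cbar c) /\
  Q = allocation_problem A n [set x | 0 <= x] (ztilde A cbar C mu).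

(* Main.v *)
Require Import Defs.
From HB Require Import structures.
From mathcomp Require Import all_boot all_order all_algebra.
From mathcomp Require Import all_classical all_reals all_analysis.
From mathcomp Require Import measurable_realfun ring.
Set Implicit Arguments.
Unset Strict Implicit.
Unset Printing Implicit Defensive.
Import Order.TTheory GRing.Theory Num.Theory.
Import numFieldNormedType.Exports.
Local Open Scope classical_set_scope.
Local Open Scope ring_scope.

(** The two feasible sets agree by definition, so the content is the equality
    of the objective functions. For one origin-destination pair, the map
    sigma |-> v = cbar - C - sigma is a bijection of R^T that turns the
    Lagrangian q S(v) + f . sigma into f . (cbar - C) - (f . v - q S(v)).
    Its infimum over sigma is therefore the constant f . (cbar - C) minus the
    supremum of f . v - q S(v), which is Hhat ([ztildeE], an instance of
    [ereal_inf_lagrangian]).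

    It remains to sum over the pairs. Both infima and suprema may be infinite,
    and the opposite of a sum of extended reals is the sum of the opposites
    only if +oo and -oo do not both occur. Here Hhat is never -oo, since it is
    at least -q S(0) and S is finite ([expected_max_utility_fin_num]): a
    maximum of finitely many integrable variables is integrable. *)

(** R has no least element to start the iterated maximum from; one of the
    maximized terms serves instead. *)
Lemma vmaxE (R : realType) (T : finType) (t0 : T) (u : T -> R) :
  vmax u = \big[Num.max/u t0]_t u t.
Proof.
have ubu : ubound (range u) (\big[Num.max/u t0]_t u t).
  by move=> _ [t _ <-]; exact: le_bigmax.
apply/eqP; rewrite eq_le; apply/andP; split.
  by apply: ge_sup => //; exists (u t0), t0.
have le_vmax t : u t <= vmax u.
  by apply: ub_le_sup; [exists (\big[Num.max/u t0]_t u t) | exists t].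
by apply: bigmax_le => [|t _]; exact: le_vmax.
Qed.

Lemma integrable_maxr d (X : measurableType d) (R : realType)
    (mu : {measure set X -> \bar R}) (f g : X -> R) :
  mu.-integrable setT (EFin \o f) -> mu.-integrable setT (EFin \o g) ->
  mu.-integrable setT (EFin \o (f \max g)).
Proof.
move=> intf intg.
have mf : measurable_fun setT f.
  by apply/measurable_EFinP; exact: measurable_int intf.
have mg : measurable_fun setT g.
  by apply/measurable_EFinP; exact: measurable_int intg.
(* The maximum is dominated by |f| + |g|. *)
apply: (@le_integrable _ _ _ _ _ _ _
    ((EFin \o (Num.norm \o f)) \+ (EFin \o (Num.norm \o g)))%E) => //.
- by apply/measurable_EFinP; exact: measurable_maxr.
- move=> x _ /=; rewrite lee_fin [leRHS]ger0_norm ?addr_ge0//.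
  by rewrite maxEle; case: ifP => _; rewrite ?lerDl ?lerDr.
- by apply: integrableD => //; exact: integrable_norm.
Qed.

Lemma integrable_bigmaxr d (X : measurableType d) (R : realType)
    (mu : {measure set X -> \bar R}) (I : Type) (s : seq I)
    (f0 : X -> R) (f : I -> X -> R) :
  mu.-integrable setT (EFin \o f0) ->
  (forall i, mu.-integrable setT (EFin \o f i)) ->
  mu.-integrable setT (fun x => (\big[Num.max/f0 x]_(i <- s) f i x)%:E).
Proof.
move=> intf0 intf; elim: s => [|i s IHs].
  by under eq_fun do rewrite big_nil.
under eq_fun do rewrite big_cons.
exact: integrable_maxr.
Qed.

Lemma expected_max_utility_fin_num (R : realType) (T : finType)
    (mu : probability (random_vector_space R T) R) (v : T -> R) :
  (0 < #|T|)%N -> finite_means mu -> expected_max_utility mu v \is a fin_num.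
Proof.
move=> /card_gt0P[t0 _] means; rewrite /expected_max_utility unlock.
apply: integrable_fin_num => //.
have int_shift t : mu.-integrable setT
    (EFin \o (fun x : random_vector_space R T => v t + x t)).
  exact: (integrableD measurableT
    (finite_measure_integrable_cst mu (v t) measurableT) (means t)).
have := integrable_bigmaxr (index_enum T) (int_shift t0) int_shift.
apply: eq_integrable => //.
by move=> x _; rewrite (vmaxE t0).
Qed.

Lemma ereal_sup_subr (R : realType) (S : set (\bar R)) (k : R) :
  (ereal_sup [set x - k%:E | x in S] = ereal_sup S - k%:E)%E.
Proof.
apply/eqP; rewrite eq_le; apply/andP; split.
  apply: ge_ereal_sup => _ [x Sx <-].
  by apply: leeB => //; exact: ereal_sup_ubound.
rewrite leeBlDr//; apply: ge_ereal_sup => x Sx.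
by rewrite -leeBlDr//; apply: ereal_sup_ubound; exists x.
Qed.

(** The change of variables v = k - sigma behind the proposition: the
    Lagrangian dual value is a constant minus the convex conjugate of s. *)
Lemma ereal_inf_lagrangian (R : realType) (T : finType)
    (s : (T -> R) -> R) (f k : T -> R) :
  (ereal_inf (range (fun sigma : T -> R =>
      (s (fun t => k t - sigma t) + \sum_t f t * sigma t)%R%:E)) =
   (\sum_t f t * k t)%R%:E
     - ereal_sup (range (fun v : T -> R => (\sum_t f t * v t - s v)%R%:E)))%E.
Proof.
have sumB (u v : T -> R) :
    \sum_t f t * (u t - v t) = \sum_t f t * u t - \sum_t f t * v t.
  by rewrite -sumrB; apply: eq_bigr => t _; rewrite mulrBr.
have kK (u : T -> R) : (fun t => k t - (k t - u t)) = u.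
  by apply/funext => t; rewrite subKr.
rewrite addeC -[X in (_ + X)%E]oppeK -fin_num_oppeD// -ereal_sup_subr.
rewrite /ereal_inf; congr (- ereal_sup _)%E.
apply/seteqP; split => [_ [_ [sigma _ <-] <-]|_ [_ [v _ <-] <-]].
  exists (\sum_t f t * (k t - sigma t) - s (fun t => k t - sigma t))%:E.
    by exists (fun t => k t - sigma t).
  by rewrite -EFinB -EFinN sumB; congr EFin; ring.
exists (s v + \sum_t f t * (k t - v t))%:E.
  by exists (fun t => k t - v t) => //; rewrite kK.
by rewrite -EFinB -EFinN sumB; congr EFin; ring.
Qed.

Section PerturbedProblem.
Variables (R : realType) (W T : finType) (A : W -> finType).
Variables (cbar : T -> R) (C : W -> T -> R).
Variable mu : W -> probability (random_vector_space R T) R.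
Hypothesis T_neq0 : (0 < #|T|)%N.
Hypothesis means : forall od, finite_means (mu od).

Let S od v := fine (expected_max_utility (mu od) v).

Let SE od v : expected_max_utility (mu od) v = (S od v)%:E.
Proof. by rewrite fineK// expected_max_utility_fin_num. Qed.

Lemma HhatE od (f : T -> R) :
  Hhat A mu od f = ereal_sup (range (fun v : T -> R =>
    (\sum_rs f rs * v rs - #|A od|%:R * S od v)%R%:E)).
Proof.
by congr ereal_sup; apply: eq_imagel => v _; rewrite SE EFinB EFinM.
Qed.

Lemma Hhat_gtNy od (f : T -> R) : (-oo < Hhat A mu od f)%E.
Proof.
rewrite HhatE; set g := fun v => _.
apply: (@lt_le_trans _ _ (g (fun=> 0))); first exact: ltNyr.
by apply: ereal_sup_ubound; exists (fun=> 0).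
Qed.

Lemma ztildeE od (f : T -> R) :
  ztilde A cbar C mu od f =
  ((\sum_rs f rs * (cbar rs - C od rs))%R%:E - Hhat A mu od f)%E.
Proof.
rewrite HhatE -(ereal_inf_lagrangian (fun v => #|A od|%:R * S od v)).
congr ereal_inf; apply: eq_imagel => sigma _.
by rewrite SE EFinD EFinM; do 4 f_equal; apply/funext => rs; rewrite addrAC.
Qed.

(** This holds for every f, feasible or not: the subtraction distributes over
    the sum because no Hhat is -oo, even when some of them are +oo. *)
Lemma sum_ztilde (f : W -> T -> R) :
  (\sum_od ztilde A cbar C mu od (f od) =
   (\sum_od \sum_rs f od rs * (cbar rs - C od rs))%R%:E
     - \sum_od Hhat A mu od (f od))%E.
Proof.
under eq_bigr do rewrite ztildeE.
rewrite big_split/= sumEFin sumeN// => od od' _ _.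
by apply: ltninfty_adde_def; rewrite inE Hhat_gtNy.
Qed.

End PerturbedProblem.

Theorem proposition3 (R : realType) (W T : finType) (A : W -> finType)
    (W_neq0 : (0 < #|W|)%N) (T_neq0 : (0 < #|T|)%N)
    (A_neq0 : forall od, (0 < #|A od|)%N)
    (n : T -> nat) (cbar : T -> R)
    (d : measure_display) (Omega : measurableType d)
    (P : probability Omega R)
    (mu : W -> probability (random_vector_space R T) R)
    (C : W -> T -> R)
    (eps : forall od, A od -> Omega -> random_vector_space R T)
    (delta : R) (c : Omega -> forall od, A od -> T -> R)
    (aru : additive_random_utility P mu C eps delta c)
    (w : Omega) :
  is_fluid_approximation n cbar (c w) C mu
    (master_problem n cbar (c w)) (perturbed_problem A n cbar C mu).
Proof.
split => //; rewrite /perturbed_problem /allocation_problem; congr MaxProblem.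
apply/funext => f; rewrite sum_ztilde//.
exact: aru_finite_means aru.
Qed.
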